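(* For a topological group $X$ the following conditions are equivalent: (1) $X$ is complete-metrizable (i.e. homeomorphic to a complete metric space); (2) $X$ is a point-cosmic Choquet space; (3) $X$ is a Choquet $\sigma$-space.
   Context: Topological groups are assumed Hausdorff. A family $\mathcal N$ of subsets of a topological space $X$ is a network at a point $x\in X$ if for every neighborhood $O_x$ of $x$ the union $\bigcup\{N\in\mathcal N: N\subset O_x\}$ is a neighborhood of $x$; $\mathcal N$ is a network if it is a network at each point of $X$. A regular topological space $X$ is point-cosmic if each point $x\in X$ has a countable network at $x$. A regular space is a $\sigma$-space if it has a $\sigma$-discrete network. The Choquet game $\mathsf{G}_{EN}(X)$ on a space $X$: player $\mathsf E$ starts by choosing a non-empty open set $U_0\subset X$, player $\mathsf N$ responds with a non-empty open $U_1\subset U_0$, and at the $n$-th inning $\mathsf E$ chooses a non-empty open $U_{2n}\subset U_{2n-1}$ and $\mathsf N$ responds with a non-empty open $U_{2n+1}\subset U_{2n}$; $\mathsf E$ wins if $\bigcap_{n\in\omega}U_n=\emptyset$, otherwise $\mathsf N$ wins. $X$ is Choquet if $\mathsf N$ has a winning strategy in this game. *)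

(* Defs.v *)
From Stdlib Require Import Reals List.
Open Scope R_scope.

Record Topology (X : Type) := {
  is_open : (X -> Prop) -> Prop;
  open_full : is_open (fun _ => True);
  open_inter : forall U V, is_open U -> is_open V ->
                 is_open (fun x => U x /\ V x);
  open_union : forall F : (X -> Prop) -> Prop,
                 (forall U, F U -> is_open U) ->
                 is_open (fun x => exists U, F U /\ U x)
}.
Arguments is_open {X} _ _.

Definition subset {X : Type} (A B : X -> Prop) : Prop := forall x, A x -> B x.
Definition nonempty {X : Type} (A : X -> Prop) : Prop := exists x, A x.

Definition neighborhood {X : Type} (T : Topology X) (x : X) (A : X -> Prop) :=
  exists U, is_open T U /\ U x /\ subset U A.

Definition closure {X : Type} (T : Topology X) (A : X -> Prop) : X -> Prop :=
  fun y => forall U, is_open T U -> U y -> exists z, U z /\ A z.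

Definition hausdorff {X : Type} (T : Topology X) : Prop :=
  forall x y, x <> y -> exists U V, is_open T U /\ is_open T V /\ U x /\ V y /\
    (forall z, U z -> V z -> False).

Definition T1 {X : Type} (T : Topology X) : Prop :=
  forall x y, x <> y -> exists U, is_open T U /\ U x /\ ~ U y.

Definition regular {X : Type} (T : Topology X) : Prop :=
  T1 T /\
  forall x U, is_open T U -> U x ->
    exists V, is_open T V /\ V x /\ subset (closure T V) U.

Definition topological_group {X : Type} (T : Topology X)
  (mul : X -> X -> X) (inv : X -> X) (e : X) : Prop :=
  (forall a b c, mul a (mul b c) = mul (mul a b) c) /\
  (forall a, mul e a = a) /\
  (forall a, mul (inv a) a = e) /\
  (forall a b W, is_open T W -> W (mul a b) ->
     exists U V, is_open T U /\ is_open T V /\ U a /\ V b /\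
       (forall u v, U u -> V v -> W (mul u v))) /\
  (forall W, is_open T W -> is_open T (fun x => W (inv x))) /\
  hausdorff T.

Definition is_metric {X : Type} (d : X -> X -> R) : Prop :=
  (forall x y, 0 <= d x y) /\
  (forall x y, d x y = 0 <-> x = y) /\
  (forall x y, d x y = d y x) /\
  (forall x y z, d x z <= d x y + d y z).

Definition metric_induces {X : Type} (T : Topology X) (d : X -> X -> R) : Prop :=
  forall U, is_open T U <->
    (forall x, U x -> exists eps, 0 < eps /\ forall y, d x y < eps -> U y).

Definition metric_complete {X : Type} (d : X -> X -> R) : Prop :=
  forall s : nat -> X,
    (forall eps, 0 < eps -> exists N, forall m n, (N <= m)%nat -> (N <= n)%nat ->
        d (s m) (s n) < eps) ->
    exists x, forall eps, 0 < eps -> exists N, forall n, (N <= n)%nat -> d (s n) x < eps.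

(* homeomorphic to a complete metric space = topology generated by a complete metric *)
Definition complete_metrizable {X : Type} (T : Topology X) : Prop :=
  exists d : X -> X -> R, is_metric d /\ metric_induces T d /\ metric_complete d.

Definition family (X : Type) := (X -> Prop) -> Prop.

Definition countable_family {X : Type} (F : family X) : Prop :=
  exists f : nat -> (X -> Prop), forall N, F N -> exists n, f n = N.

Definition network_at {X : Type} (T : Topology X) (F : family X) (x : X) : Prop :=
  forall O, neighborhood T x O ->
    neighborhood T x (fun y => exists N, F N /\ subset N O /\ N y).

Definition network {X : Type} (T : Topology X) (F : family X) : Prop :=
  forall x, network_at T F x.

Definition point_cosmic {X : Type} (T : Topology X) : Prop :=
  regular T /\ forall x, exists F, countable_family F /\ network_at T F x.

Definition discrete_family {X : Type} (T : Topology X) (F : family X) : Prop :=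
  forall x, exists U, neighborhood T x U /\
    forall N1 N2, F N1 -> F N2 ->
      (exists y, U y /\ N1 y) -> (exists y, U y /\ N2 y) ->
      forall z, N1 z <-> N2 z.

Definition sigma_discrete {X : Type} (T : Topology X) (F : family X) : Prop :=
  exists D : nat -> family X,
    (forall n, discrete_family T (D n)) /\
    (forall N, F N <-> exists n, D n N).

Definition sigma_space {X : Type} (T : Topology X) : Prop :=
  regular T /\ exists F, sigma_discrete T F /\ network T F.

(* A strategy of player N maps the history of all moves so far
   [U_0; ...; U_2n] to the response U_{2n+1}. *)
Definition N_strategy {X : Type} (T : Topology X)
  (sigma : list (X -> Prop) -> (X -> Prop)) : Prop :=
  forall h V, is_open T V -> nonempty V ->
    is_open T (sigma (h ++ V :: nil)) /\ nonempty (sigma (h ++ V :: nil)) /\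
    subset (sigma (h ++ V :: nil)) V.

Definition play_by {X : Type} (T : Topology X)
  (sigma : list (X -> Prop) -> (X -> Prop)) (U : nat -> (X -> Prop)) : Prop :=
  is_open T (U 0%nat) /\ nonempty (U 0%nat) /\
  (forall n, U (2 * n + 1)%nat = sigma (map U (seq 0 (2 * n + 1)))) /\
  (forall n, is_open T (U (2 * n + 2)%nat) /\ nonempty (U (2 * n + 2)%nat) /\
             subset (U (2 * n + 2)%nat) (U (2 * n + 1)%nat)).

Definition choquet {X : Type} (T : Topology X) : Prop :=
  exists sigma, N_strategy T sigma /\
    forall U, play_by T sigma U -> exists x, forall n, U n x.

(* Main.v *)
(* A Choquet space is Baire. In a Baire space a countable network at a point yields
   countably many open sets among which every neighbourhood of that point contains a
   non-empty one, and a sigma-discrete network yields a countable base at some point;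
   in a group either gives a countable base at the unit. The two-sided uniformity is
   then metrizable, and it is complete: playing the game simultaneously near a point z
   and near its translate w by a Cauchy sequence that need not converge yet, the winning
   strategy produces z and w in the group, so the limit z w^-1 lies in the group. *)
From Stdlib Require Import Reals List Lra Lia Wf_nat Cantor.
From Stdlib Require Import Classical ClassicalChoice.
From Stdlib Require Import FunctionalExtensionality PropExtensionality.
From mathcomp Require boolp wochoice.
Require Import Defs.
Import ListNotations.
Set Bullet Behavior "Strict Subproofs".

(** * Well-ordering, dependent choice and elementary topology *)

Lemma well_ordering (X : Type) : exists le : X -> X -> Prop,
  (forall x y, le x y -> le y x -> x = y) /\
  (forall P : X -> Prop, nonempty P -> exists m, P m /\ forall y, P y -> le m y).
Proof.
  destruct (wochoice.well_ordering_principle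
    (boolp.boolp_classicType__canonical__eqtype_Equality X)) as [R HR].
  assert (Hmin : forall P : X -> Prop, nonempty P ->
    exists m, (P m /\ forall y, P y -> R m y = true) /\
      forall m', P m' /\ (forall y, P y -> R m' y = true) -> m = m').
  { intros P [x Hx].
    destruct (HR (fun x => boolp.asbool (P x))) as [m [[Hm1 Hm2] Hu]].
    - exists x. now apply boolp.asboolT.
    - exists m. repeat split.
      + apply boolp.asboolW, Hm1.
      + intros y Hy. apply Hm2. now apply boolp.asboolT.
      + intros m' [H1 H2]. apply Hu. split.
        * now apply boolp.asboolT.
        * intros y Hy. apply H2. apply boolp.asboolW, Hy. }
  exists (fun x y => R x y = true). split.
  - assert (Hrefl : forall x, R x x = true).
    { intros x. destruct (Hmin (eq x)) as [m [[-> Hm] _]]; [now exists x | now apply Hm]. }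
    intros x y Hxy Hyx.
    (* Antisymmetry comes from uniqueness of the minimum: [x] and [y] are both minima of the
       pair. *)
    destruct (Hmin (fun z => z = x \/ z = y)) as [m [_ Hu]]; [exists x; now left|].
    transitivity m; [symmetry|]; apply Hu; split; auto; intros z [->| ->]; auto.
  - intros P HP. destruct (Hmin P HP) as [m [Hm _]]. now exists m.
Qed.

Lemma dependent_choice {S : Type} (I : nat -> S -> Prop) (R : nat -> S -> S -> Prop) :
  (exists s, I 0%nat s) ->
  (forall n s, I n s -> exists s', I (Datatypes.S n) s' /\ R n s s') ->
  exists f, forall n, I n (f n) /\ R n (f n) (f (Datatypes.S n)).
Proof.
  intros [s0 H0] Hstep.
  (* [choice] needs a total relation, so the step is conditional on the invariant; where [I] fails
     any successor serves. *)
  destruct (choice (fun p s' => I (fst p) (snd p) ->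
    I (Datatypes.S (fst p)) s' /\ R (fst p) (snd p) s')) as [g Hg].
  { intros [n s]. destruct (classic (I n s)) as [H|H].
    - destruct (Hstep n s H) as [s' H']. now exists s'.
    - now exists s. }
  set (f := nat_rect (fun _ => S) s0 (fun n s => g (n, s))).
  assert (HI : forall n, I n (f n)).
  { induction n as [|n IH]; [exact H0 | exact (proj1 (Hg (n, f n) IH))]. }
  exists f. intros n. split; [apply HI | exact (proj2 (Hg (n, f n) (HI n)))].
Qed.

Lemma set_ext {X : Type} (A B : X -> Prop) : (forall x, A x <-> B x) -> A = B.
Proof.
  intros H. apply functional_extensionality. intros x.
  apply propositional_extensionality, H.
Qed.

Lemma open_of_local {X : Type} (T : Topology X) (U : X -> Prop) :
  (forall x, U x -> neighborhood T x U) -> is_open T U.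
Proof.
  intros H.
  replace U with (fun x => exists V, (is_open T V /\ subset V U) /\ V x).
  - apply open_union. now intros V [HV _].
  - apply set_ext. intros x. split.
    + intros [V [[_ HV] Hx]]. now apply HV.
    + intros Hx. destruct (H x Hx) as [V [H1 [H2 H3]]]. now exists V.
Qed.

Lemma subset_closure {X : Type} (T : Topology X) (A : X -> Prop) : subset A (closure T A).
Proof. intros x Hx U _ HU. now exists x. Qed.

Lemma not_closure {X : Type} (T : Topology X) (A : X -> Prop) x :
  ~ closure T A x -> exists U, is_open T U /\ U x /\ forall y, U y -> ~ A y.
Proof.
  intros Hx. apply NNPP. intros Hn. apply Hx. intros U HU Ux.
  apply NNPP. intros Hn'. apply Hn. exists U. repeat split; auto.
  intros y Hy HA. apply Hn'. now exists y.
Qed.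

(** * The Choquet game *)

Definition nonempty_open {X : Type} (T : Topology X) (U : X -> Prop) : Prop :=
  is_open T U /\ nonempty U.

(* A position records the moves of the previous innings; [next p V] is the
   position after the inning in which E plays [V] and N answers [reply p V]. *)
Lemma choquet_positions {X : Type} (T : Topology X) : choquet T ->
  exists (P : Type) (p0 : P) (next : P -> (X -> Prop) -> P)
         (reply : P -> (X -> Prop) -> (X -> Prop)),
    (forall p V, nonempty_open T V ->
       nonempty_open T (reply p V) /\ subset (reply p V) V) /\
    (forall (p : nat -> P) (V : nat -> X -> Prop),
       p 0%nat = p0 -> (forall n, p (S n) = next (p n) (V n)) ->
       (forall n, nonempty_open T (V n)) ->
       (forall n, subset (V (S n)) (reply (p n) (V n))) ->
       exists x, forall n, V n x).
Proof.
  intros [sigma [Hs Hwin]].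
  exists (list (X -> Prop)), [],
    (fun h V => h ++ [V; sigma (h ++ [V])]), (fun h V => sigma (h ++ [V])).
  split.
  { intros h V [HV HV']. destruct (Hs h V HV HV') as [H1 [H2 H3]]. now repeat split. }
  cbv beta. intros h V h0 hS HV Hsub.
  set (U := fun k => if Nat.even k then V (Nat.div2 k)
                     else sigma (h (Nat.div2 k) ++ [V (Nat.div2 k)])).
  assert (Ue : forall n, U (2 * n)%nat = V n).
  { intros n. unfold U. rewrite Nat.even_mul, Nat.div2_double. reflexivity. }
  assert (Uo : forall n, U (S (2 * n)) = sigma (h n ++ [V n])).
  { intros n. unfold U.
    rewrite Nat.even_succ, <- Nat.negb_even, Nat.even_mul, Nat.div2_succ_double. reflexivity. }
  (* The position [h n] is literally the list of the first [2 * n] moves, so the replies made from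
     positions are those of [sigma] in an actual play. *)
  assert (Hh : forall n, map U (seq 0 (2 * n)) = h n).
  { induction n as [|n IH]; [now rewrite h0|].
    replace (2 * S n)%nat with (2 * n + 2)%nat by lia.
    rewrite seq_app, map_app, IH, hS.
    change (seq (0 + 2 * n) 2) with [(2 * n)%nat; S (2 * n)].
    cbn [map]. now rewrite Ue, Uo. }
  assert (Hplay : play_by T sigma U).
  { split; [|split; [|split]].
    + change 0%nat with (2 * 0)%nat. rewrite Ue. apply HV.
    + change 0%nat with (2 * 0)%nat. rewrite Ue. apply HV.
    + intros n. replace (2 * n + 1)%nat with (S (2 * n)) by lia.
      rewrite Uo. replace (S (2 * n)) with (2 * n + 1)%nat by lia.
      rewrite seq_app, map_app, Hh.
      change (seq (0 + 2 * n) 1) with [(2 * n)%nat]. cbn [map]. now rewrite Ue.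
    + intros n. replace (2 * n + 2)%nat with (2 * S n)%nat by lia.
      replace (2 * n + 1)%nat with (S (2 * n)) by lia.
      rewrite Ue, Uo. split; [apply HV | split; [apply HV | apply Hsub]]. }
  destruct (Hwin U Hplay) as [x Hx].
  exists x. intros n. rewrite <- Ue. apply Hx.
Qed.

Definition nowhere_dense {X : Type} (T : Topology X) (A : X -> Prop) : Prop :=
  forall U, nonempty_open T U ->
    exists V, nonempty_open T V /\ subset V U /\ forall x, V x -> ~ A x.

(** In inning [n] player E chooses an open part of N's last reply (of [O] at the start) that misses
    [A n]. The point granted by N's winning strategy then lies in [O] and avoids every [A n]. *)
Lemma choquet_baire {X : Type} (T : Topology X) : choquet T ->
  forall (A : nat -> X -> Prop), (forall n, nowhere_dense T (A n)) ->
  forall O, nonempty_open T O -> exists x, O x /\ forall n, ~ A n x.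
Proof.
  intros HC A HA O HO.
  destruct (choquet_positions T HC) as [P [p0 [next [reply [Hr Hwin]]]]].
  (* The clause for [n = 0] in the invariant pins the initial position, which [dependent_choice]
     does not return by itself. *)
  destruct (dependent_choice
    (fun n (s : P * (X -> Prop)) => (n = 0%nat -> fst s = p0) /\ nonempty_open T (snd s) /\
       subset (snd s) O /\ forall x, snd s x -> ~ A n x)
    (fun n s s' => fst s' = next (fst s) (snd s) /\ subset (snd s') (reply (fst s) (snd s))))
    as [f Hf].
  - destruct (HA 0%nat O HO) as [V [H1 [H2 H3]]]. now exists (p0, V).
  - intros n [p V] [_ [HV [HVO _]]]. simpl in *.
    destruct (Hr p V HV) as [H1 H2].
    destruct (HA (S n) _ H1) as [V' [H3 [H4 H5]]].
    exists (next p V, V'). simpl. repeat split; auto; try apply H3.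
    + discriminate.
    + intros x Hx. auto.
  - destruct (Hwin (fun n => fst (f n)) (fun n => snd (f n))) as [x Hx].
    + now apply (Hf 0%nat).
    + intros n. apply (Hf n).
    + intros n. apply (Hf n).
    + intros n. apply (Hf n).
    + exists x. split.
      * apply (Hf 0%nat), Hx.
      * intros n. apply (Hf n), Hx.
Qed.

(** * Metrization by a sequence of entourages *)

Lemma half_pow_pos n : 0 < (/2) ^ n.
Proof. apply pow_lt. lra. Qed.

Lemma half_pow_le m n : (m <= n)%nat -> (/2) ^ n <= (/2) ^ m.
Proof.
  induction 1 as [|n _ IH]; [lra|].
  simpl. pose proof (half_pow_pos n). lra.
Qed.

Lemma half_pow_small eps : 0 < eps -> exists n, (/2) ^ n < eps.
Proof.
  intros Heps. destruct (pow_lt_1_zero (/2)) with (y := eps) as [n Hn]; auto.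
  { rewrite Rabs_right; lra. }
  exists n. specialize (Hn n (le_n n)).
  rewrite Rabs_right in Hn; auto. apply Rle_ge, Rlt_le, half_pow_pos.
Qed.

(* [chain E k x y s]: a path of [k] steps from [x] to [y], where a step in [E n]
   costs 2^-n and [s] is the total cost. *)
Inductive chain {X : Type} (E : nat -> X -> X -> Prop) : nat -> X -> X -> R -> Prop :=
| chain_nil x : chain E 0 x x 0
| chain_cons k n x y z s :
    E n x y -> chain E k y z s -> chain E (S k) x z ((/2) ^ n + s).

Lemma chain_nonneg {X : Type} (E : nat -> X -> X -> Prop) k x y s :
  chain E k x y s -> 0 <= s.
Proof.
  induction 1 as [|k n x y z s _ _ IH]; [lra|].
  pose proof (half_pow_pos n). lra.
Qed.

Lemma chain_app {X : Type} (E : nat -> X -> X -> Prop) k x y s :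
  chain E k x y s -> forall l z t, chain E l y z t -> chain E (k + l) x z (s + t).
Proof.
  induction 1 as [x|k n x y z s Hxy _ IH]; intros l w t Hc; simpl.
  - now rewrite Rplus_0_l.
  - rewrite Rplus_assoc. apply chain_cons with y; auto.
Qed.

Lemma chain_step {X : Type} (E : nat -> X -> X -> Prop) n x y :
  E n x y -> chain E 1 x y ((/2) ^ n).
Proof.
  intros H. rewrite <- Rplus_0_r. apply chain_cons with y; auto. constructor.
Qed.

Lemma chain_sym {X : Type} (E : nat -> X -> X -> Prop) :
  (forall n x y, E n x y -> E n y x) ->
  forall k x y s, chain E k x y s -> chain E k y x s.
Proof.
  intros Hsym k x y s. induction 1 as [x|k n x y z s Hxy _ IH]; [constructor|].
  replace (S k) with (k + 1)%nat by lia. rewrite Rplus_comm.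
  apply chain_app with y; auto. now apply chain_step, Hsym.
Qed.

(** The middle step is the one during which the running cost passes [t]. *)
Lemma chain_split {X : Type} (E : nat -> X -> X -> Prop) k x y s :
  chain E k x y s -> forall t, 0 <= t <= s -> (0 < k)%nat ->
  exists i j n a b s1 s2, chain E i x a s1 /\ E n a b /\ chain E j b y s2 /\
    k = (i + 1 + j)%nat /\ s = s1 + (/2) ^ n + s2 /\ s1 <= t <= s1 + (/2) ^ n.
Proof.
  induction 1 as [x|k n x y z s Hxy Hc IH]; intros t Ht Hk; [lia|].
  destruct (Rle_lt_dec t ((/2) ^ n)) as [Htn|Htn].
  - exists 0%nat, k, n, x, y, 0, s. repeat split; auto; try lra. constructor.
  - destruct (Nat.eq_dec k 0) as [->|Hk0].
    + inversion Hc; subst. lra.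
    + destruct (IH (t - (/2) ^ n)) as
        (i & j & m & a & b & s1 & s2 & H1 & H2 & H3 & H4 & H5 & H6); [lra|lia|].
      exists (S i), j, m, a, b, ((/2) ^ n + s1), s2.
      repeat split; auto; try lra; try lia.
      now apply chain_cons with y.
Qed.

Lemma entourage_mono {X : Type} (E : nat -> X -> X -> Prop) :
  (forall n x, E n x x) ->
  (forall n x y z w, E (S n) x y -> E (S n) y z -> E (S n) z w -> E n x w) ->
  forall m n x y, (m <= n)%nat -> E n x y -> E m x y.
Proof.
  intros Hrefl Hcomp m n x y. induction 1 as [|n _ IH]; auto.
  intros H. apply IH. now apply Hcomp with x x.
Qed.

(* Cut the path at half of its cost: both halves are cheap and shorter, and
   the step in the middle is cheap as well. *)
Lemma chain_entourage {X : Type} (E : nat -> X -> X -> Prop) :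
  (forall n x, E n x x) ->
  (forall n x y z w, E (S n) x y -> E (S n) y z -> E (S n) z w -> E n x w) ->
  forall k x y s n, chain E k x y s -> s < (/2) ^ n -> E n x y.
Proof.
  intros Hrefl Hcomp k. induction k as [k IH] using lt_wf_ind.
  intros x y s n Hc Hs.
  destruct (Nat.eq_dec k 0) as [->|Hk].
  { inversion Hc; subst. apply Hrefl. }
  pose proof (chain_nonneg E k x y s Hc) as Hs0.
  destruct (chain_split E k x y s Hc (s / 2)) as
    (i & j & m & a & b & s1 & s2 & H1 & H2 & H3 & H4 & H5 & H6); [lra|lia|].
  pose proof (chain_nonneg E _ _ _ _ H1). pose proof (chain_nonneg E _ _ _ _ H3).
  apply Hcomp with a b.
  - apply (IH i) with s1; [lia|auto|simpl; lra].
  - apply (entourage_mono E Hrefl Hcomp) with m; auto.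
    destruct (Nat.le_gt_cases m n) as [Hmn|Hmn]; [|lia].
    pose proof (half_pow_le m n Hmn). lra.
  - apply (IH j) with s2; [lia|auto|simpl; lra].
Qed.

Lemma glb_exists (P : R -> Prop) : (exists s, P s) -> (forall s, P s -> 0 <= s) ->
  exists m, (forall s, P s -> m <= s) /\ forall eps, 0 < eps -> exists s, P s /\ s < m + eps.
Proof.
  intros [s0 Hs0] Hpos.
  destruct (completeness (fun r => P (- r))) as [l [Hl1 Hl2]].
  - exists 0. intros r Hr. specialize (Hpos _ Hr). lra.
  - exists (- s0). now rewrite Ropp_involutive.
  - exists (- l). split.
    + intros s Hs. assert (- s <= l); [|lra].
      apply Hl1. now rewrite Ropp_involutive.
    + intros eps Heps. apply NNPP. intros Hn.
      assert (l <= l - eps); [|lra].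
      apply Hl2. intros r Hr. apply Rnot_lt_le. intros Hlt. apply Hn.
      exists (- r). split; [auto|lra].
Qed.

(** The distance is the infimum of the costs of paths. Concatenation and reversal of paths give the
    triangle inequality and symmetry; [chain_entourage] bounds the infimum from below, which gives
    separation. Since [E 0] relates all points, a path always exists. *)
Lemma entourage_metrization {X : Type} (E : nat -> X -> X -> Prop) :
  (forall x y, E 0%nat x y) ->
  (forall n x, E n x x) ->
  (forall n x y, E n x y -> E n y x) ->
  (forall n x y z w, E (S n) x y -> E (S n) y z -> E (S n) z w -> E n x w) ->
  (forall x y, (forall n, E n x y) -> x = y) ->
  exists d, is_metric d /\ (forall n x y, E n x y -> d x y <= (/2) ^ n) /\
    (forall n x y, d x y < (/2) ^ n -> E n x y).
Proof.
  intros Htot Hrefl Hsym Hcomp Hsep.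
  destruct (choice (fun (p : X * X) m =>
    (forall k s, chain E k (fst p) (snd p) s -> m <= s) /\
    forall eps, 0 < eps -> exists k s, chain E k (fst p) (snd p) s /\ s < m + eps))
    as [d Hd].
  { intros [x y]. simpl.
    destruct (glb_exists (fun s => exists k, chain E k x y s)) as [m [H1 H2]].
    - exists ((/2) ^ 0), 1%nat. now apply chain_step.
    - intros s [k Hk]. now apply chain_nonneg in Hk.
    - exists m. split; [intros k s Hk; apply H1; now exists k|].
      intros eps Heps. destruct (H2 eps Heps) as [s [[k Hk] Hs]]. now exists k, s. }
  assert (Hle : forall x y k s, chain E k x y s -> d (x, y) <= s).
  { intros x y. apply (Hd (x, y)). }
  assert (Hnear : forall x y eps, 0 < eps -> exists k s, chain E k x y s /\ s < d (x, y) + eps).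
  { intros x y. apply (Hd (x, y)). }
  assert (Hpos : forall x y, 0 <= d (x, y)).
  { intros x y. apply Rnot_lt_le. intros Hlt.
    destruct (Hnear x y (- d (x, y))) as [k [s [Hc Hs]]]; [lra|].
    apply chain_nonneg in Hc. lra. }
  assert (Hent : forall n x y, d (x, y) < (/2) ^ n -> E n x y).
  { intros n x y Hlt. destruct (Hnear x y ((/2) ^ n - d (x, y))) as [k [s [Hc Hs]]]; [lra|].
    apply (chain_entourage E Hrefl Hcomp) with k s; auto. lra. }
  assert (Hle_sym : forall x y, d (x, y) <= d (y, x)).
  { intros x y. apply le_epsilon. intros eps Heps.
    destruct (Hnear y x eps Heps) as [k [s [Hc Hs]]].
    apply chain_sym, Hle in Hc; auto. lra. }
  exists (fun x y => d (x, y)). split; [|split; auto].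
  - split; [auto|split; [|split]].
    + intros x y. split.
      * intros H0. apply Hsep. intros n. apply Hent. rewrite H0. apply half_pow_pos.
      * intros ->. apply Rle_antisym; auto. apply Hle with 0%nat. constructor.
    + intros x y. now apply Rle_antisym.
    + intros x y z. apply le_epsilon. intros eps Heps.
      destruct (Hnear x y (eps / 2)) as [k [s [Hc Hs]]]; [lra|].
      destruct (Hnear y z (eps / 2)) as [l [t [Hc' Ht]]]; [lra|].
      pose proof (Hle _ _ _ _ (chain_app E k x y s Hc l z t Hc')). lra.
  - intros n x y H. apply Hle with 1%nat. now apply chain_step.
Qed.

(** * Complete metric spaces *)

Definition ball {X : Type} (d : X -> X -> R) (x : X) (r : R) : X -> Prop :=
  fun y => d x y < r.

Lemma ball_center {X : Type} (d : X -> X -> R) x r : is_metric d -> 0 < r -> ball d x r x.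
Proof.
  intros [_ [H0 _]] Hr. unfold ball. now rewrite (proj2 (H0 x x) eq_refl).
Qed.

Lemma ball_open {X : Type} (T : Topology X) d x r :
  is_metric d -> metric_induces T d -> is_open T (ball d x r).
Proof.
  intros (_ & _ & _ & Htri) Hind. apply Hind. intros y Hy. unfold ball in *.
  exists (r - d x y). split; [lra|].
  intros z Hz. specialize (Htri x y z). lra.
Qed.

Lemma metric_regular {X : Type} (T : Topology X) d :
  is_metric d -> metric_induces T d -> regular T.
Proof.
  intros Hm Hind. pose proof Hm as (Hpos & H0 & Hsym & Htri). split.
  - intros x y Hxy. exists (ball d x (d x y)).
    assert (0 < d x y).
    { destruct (Hpos x y) as [H|H]; auto. now destruct Hxy; apply H0. }
    split; [now apply ball_open|split; [now apply ball_center|]].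
    unfold ball. lra.
  - intros x U HU Hx. destruct (proj1 (Hind U) HU x Hx) as [eps [Heps Hball]].
    exists (ball d x (eps / 2)).
    split; [now apply ball_open|split; [apply ball_center; auto; lra|]].
    intros y Hy. apply Hball.
    destruct (Hy (ball d y (eps / 2))) as [z [Hyz Hxz]].
    + now apply ball_open.
    + apply ball_center; auto; lra.
    + unfold ball in *. specialize (Htri x z y). rewrite (Hsym z y) in Htri. lra.
Qed.

Lemma metric_point_cosmic {X : Type} (T : Topology X) d :
  is_metric d -> metric_induces T d -> point_cosmic T.
Proof.
  intros Hm Hind. split; [now apply metric_regular with d|]. intros x.
  exists (fun N => exists n, ball d x ((/2) ^ n) = N). split.
  - exists (fun n => ball d x ((/2) ^ n)). auto.
  - intros O [V [HV [Vx HVO]]].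
    destruct (proj1 (Hind V) HV x Vx) as [eps [Heps Hball]].
    destruct (half_pow_small eps Heps) as [n Hn].
    exists (ball d x ((/2) ^ n)). split; [now apply ball_open|split].
    + apply ball_center; auto. apply half_pow_pos.
    + intros y Hy. exists (ball d x ((/2) ^ n)). split; [now exists n|split; auto].
      intros z Hz. apply HVO, Hball. unfold ball in Hz. lra.
Qed.

(* Stone's construction: well-order the space and assign each point to the first
   ball of radius 2^-m containing it; the points lying 2^-k deep inside their
   ball form a discrete family. *)
Lemma metric_sigma_space {X : Type} (T : Topology X) d :
  is_metric d -> metric_induces T d -> sigma_space T.
Proof.
  intros Hm Hind. split; [now apply metric_regular with d|].
  pose proof Hm as (Hpos & H0 & Hsym & Htri).
  destruct (well_ordering X) as [le [Hanti Hmin]].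
  set (C := fun (m k : nat) (x y : X) => ball d x ((/2) ^ m) y /\
    (forall x', ball d x' ((/2) ^ m) y -> le x x') /\
    subset (ball d y ((/2) ^ k)) (ball d x ((/2) ^ m))).
  set (D := fun i (N : X -> Prop) =>
    exists x, C (fst (Cantor.of_nat i)) (snd (Cantor.of_nat i)) x = N).
  exists (fun N => exists i, D i N). split; [exists D; split|].
  - intros i p. unfold D. destruct (Cantor.of_nat i) as [m k]. simpl.
    exists (ball d p ((/2) ^ S k)). split.
    { exists (ball d p ((/2) ^ S k)). split; [now apply ball_open|split; [|easy]].
      apply ball_center; auto. apply half_pow_pos. }
    intros N1 N2 [x1 <-] [x2 <-] [y1 [Hp1 (H1 & H1' & H1'')]] [y2 [Hp2 (H2 & H2' & H2'')]].
    unfold ball in Hp1, Hp2. simpl in Hp1, Hp2.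
    (* The points [y1] and [y2] are closer than 2^-k, so each lies in the ball assigned to the
       other; both centers being least, they coincide. *)
    pose proof (Htri y1 p y2) as Ht. rewrite (Hsym y1 p) in Ht.
    assert (x1 = x2) as ->; [|easy].
    apply Hanti.
    + apply H1', H2''. unfold ball. rewrite Hsym. lra.
    + apply H2', H1''. unfold ball. lra.
  - intros N. reflexivity.
  - intros p O [V [HV [Vp HVO]]].
    exists V. split; [auto|split; [auto|]]. intros y Vy.
    destruct (proj1 (Hind V) HV y Vy) as [eps [Heps Hball]].
    destruct (half_pow_small (eps / 2)) as [m Hn]; [lra|].
    destruct (Hmin (fun x => ball d x ((/2) ^ m) y)) as [x [Hx Hleast]].
    { exists y. apply ball_center; auto. apply half_pow_pos. }
    unfold ball in Hx.
    (* The slack of [y] inside its assigned ball determines how deep a layer is needed to contain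
       it. *)
    destruct (half_pow_small ((/2) ^ m - d x y)) as [k Hk]; [lra|].
    exists (C m k x). split; [|split].
    + exists (Cantor.to_nat (m, k)), x. now rewrite Cantor.cancel_of_to.
    + intros z [Hz _]. apply HVO, Hball. unfold ball in Hz.
      pose proof (Htri y x z) as Ht. rewrite (Hsym y x) in Ht. lra.
    + split; [exact Hx|split; [exact Hleast|]].
      intros z Hz. unfold ball in *. specialize (Htri x y z). lra.
Qed.

(** N replies with a ball whose closed ball lies inside E's move and whose radius is below 2^-n for
    a history of length [n]. The centers are then Cauchy, and their limit lies in all the closed
    balls, hence in all moves. *)
Lemma complete_metrizable_choquet {X : Type} (T : Topology X) :
  complete_metrizable T -> choquet T.
Proof.
  intros [d [Hm [Hind Hcomp]]]. pose proof Hm as (Hpos & H0 & Hsym & Htri).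
  set (good := fun (V : X -> Prop) n W => exists x r, 0 < r < (/2) ^ n /\
    ball d x r = W /\ forall y, d x y <= r -> V y).
  destruct (choice (fun (h : list (X -> Prop)) W =>
    nonempty_open T (last h (fun _ => True)) -> good (last h (fun _ => True)) (length h) W))
    as [sigma Hs].
  { intros h. destruct (classic (nonempty_open T (last h (fun _ => True)))) as [[HV [x Hx]]|HV].
    - destruct (proj1 (Hind _) HV x Hx) as [eps [Heps Hball]].
      pose proof (half_pow_pos (length h)) as Hp.
      exists (ball d x (Rmin eps ((/2) ^ length h) / 2)). intros _.
      exists x, (Rmin eps ((/2) ^ length h) / 2).
      pose proof (Rmin_l eps ((/2) ^ length h)). pose proof (Rmin_r eps ((/2) ^ length h)).
      pose proof (Rmin_glb_lt eps ((/2) ^ length h) 0 Heps Hp).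
      repeat split; try lra. intros y Hy. apply Hball. lra.
    (* A default reply, for histories whose last move is illegal. *)
    - now exists (fun _ => True). }
  exists sigma. split.
  { intros h V HV Hne. destruct (Hs (h ++ [V])) as (x & r & Hr & HW & Hsub).
    { rewrite last_last. now split. }
    rewrite last_last in Hsub. rewrite <- HW. split; [now apply ball_open|split].
    - exists x. apply ball_center; auto. lra.
    - intros y Hy. apply Hsub. unfold ball in Hy. lra. }
  intros U (HU0 & HU0' & Hodd & Heven).
  assert (Hgood : forall n, good (U (2 * n)%nat) (2 * n + 1)%nat (U (2 * n + 1)%nat)).
  { intros n. rewrite (Hodd n) at 1.
    assert (Hl : map U (seq 0 (2 * n + 1)) = map U (seq 0 (2 * n)) ++ [U (2 * n)%nat]).
    { now rewrite seq_app, map_app. }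
    pose proof (Hs (map U (seq 0 (2 * n + 1)))) as H.
    rewrite length_map, length_seq, Hl, last_last, <- Hl in H. apply H.
    destruct n as [|n]; [now split|].
    replace (2 * S n)%nat with (2 * n + 2)%nat by lia. split; apply Heven. }
  destruct (choice (fun n (p : X * R) => 0 < snd p < (/2) ^ (2 * n + 1) /\
    ball d (fst p) (snd p) = U (2 * n + 1)%nat /\
    forall y, d (fst p) y <= snd p -> U (2 * n)%nat y)) as [c Hc].
  { intros n. destruct (Hgood n) as (x & r & H). now exists (x, r). }
  assert (Hdec : forall n m, (n <= m)%nat -> subset (U (2 * m + 1)%nat) (U (2 * n + 1)%nat)).
  { intros n. induction 1 as [|m _ IH]; [easy|].
    intros y Hy. apply IH, Heven. replace (2 * m + 2)%nat with (2 * S m)%nat by lia.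
    destruct (Hc (S m)) as (_ & Hb & Hsub). apply Hsub.
    rewrite <- Hb in Hy. unfold ball in Hy. lra. }
  assert (Hnear : forall n m, (n <= m)%nat -> d (fst (c n)) (fst (c m)) < snd (c n)).
  { intros n m Hnm. destruct (Hc n) as (_ & Hb & _).
    change (ball d (fst (c n)) (snd (c n)) (fst (c m))). rewrite Hb.
    apply (Hdec n m Hnm). destruct (Hc m) as (Hr & Hb' & _). rewrite <- Hb'.
    apply ball_center; auto. lra. }
  destruct (Hcomp (fun n => fst (c n))) as [x Hx].
  { intros eps Heps. destruct (half_pow_small (eps / 2)) as [N HN]; [lra|].
    exists N. cbv beta. intros m n Hm' Hn'.
    pose proof (Htri (fst (c m)) (fst (c N)) (fst (c n))) as Ht.
    rewrite (Hsym (fst (c m)) (fst (c N))) in Ht.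
    pose proof (Hnear N m Hm'). pose proof (Hnear N n Hn').
    destruct (Hc N) as (Hr & _ & _).
    pose proof (half_pow_le N (2 * N + 1) ltac:(lia)). lra. }
  assert (HUx : forall n, U (2 * n)%nat x).
  { intros n. apply (Hc n). apply le_epsilon. intros eps Heps.
    destruct (Hx eps Heps) as [N HN]. cbv beta in HN.
    specialize (HN (Nat.max n N) ltac:(lia)). specialize (Hnear n (Nat.max n N) ltac:(lia)).
    specialize (Htri (fst (c n)) (fst (c (Nat.max n N))) x). lra. }
  exists x. intros n. destruct (Nat.Even_or_Odd n) as [[m ->]|[m ->]]; auto.
  apply Heven. replace (2 * m + 2)%nat with (2 * S m)%nat by lia. apply HUx.
Qed.

(** * Countable bases from networks *)

Definition interior {X : Type} (T : Topology X) (A : X -> Prop) : X -> Prop :=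
  fun x => neighborhood T x A.

Lemma interior_open {X : Type} (T : Topology X) A : is_open T (interior T A).
Proof.
  apply open_of_local. intros x [U [HU [Ux HUA]]]. exists U. repeat split; auto.
  intros y Hy. now exists U.
Qed.

Lemma interior_subset {X : Type} (T : Topology X) A : subset (interior T A) A.
Proof. intros x [U [_ [Ux HUA]]]. auto. Qed.

Definition countable_base_at {X : Type} (T : Topology X) (x : X) : Prop :=
  exists B : nat -> X -> Prop, (forall n, is_open T (B n) /\ B n x) /\
    forall O, is_open T O -> O x -> exists n, subset (B n) O.

(** Those [B n] that are not open neighborhoods of [x] are replaced by the whole space, which does
    no harm to a base. *)
Lemma countable_base_at_intro {X : Type} (T : Topology X) (x : X) (B : nat -> X -> Prop) :
  (forall O, is_open T O -> O x -> exists n, is_open T (B n) /\ B n x /\ subset (B n) O) ->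
  countable_base_at T x.
Proof.
  intros HB.
  destruct (choice (fun n B' => (is_open T B' /\ B' x) /\
    (is_open T (B n) -> B n x -> B' = B n))) as [B' HB'].
  { intros n. destruct (classic (is_open T (B n) /\ B n x)) as [H|H].
    - now exists (B n).
    - exists (fun _ => True). split; [split; [apply open_full|easy]|].
      intros H1 H2. now destruct H. }
  exists B'. split; [intros n; apply HB'|].
  intros O HO Ox. destruct (HB O HO Ox) as [n [H1 [H2 H3]]].
  exists n. now rewrite (proj2 (HB' n) H1 H2).
Qed.

Lemma closure_mono {X : Type} (T : Topology X) A B :
  subset A B -> subset (closure T A) (closure T B).
Proof. intros HAB x Hx U HU Ux. destruct (Hx U HU Ux) as [z [H1 H2]]. exists z. auto. Qed.

(** The sets sought are the interiors of closures of network members. If none of them were non-empty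
    and inside [O], the members with closure inside [O] would be nowhere dense; by regularity these
    cover a neighborhood of [x], against the Baire property. *)
Lemma network_at_pi_base {X : Type} (T : Topology X) (x : X) (F : family X) :
  regular T -> choquet T -> countable_family F -> network_at T F x ->
  exists P : nat -> X -> Prop, forall O, is_open T O -> O x ->
    exists n, nonempty_open T (P n) /\ subset (P n) O.
Proof.
  intros [_ Hreg] HC [f Hf] HN. exists (fun n => interior T (closure T (f n))).
  intros O HO Ox. destruct (Hreg x O HO Ox) as [O1 [HO1 [O1x HO1O]]].
  destruct (HN O1) as [Q [HQ [Qx HQN]]]; [now exists O1|].
  apply NNPP. intros Hno.
  destruct (choquet_baire T HC (fun n y => f n y /\ subset (closure T (f n)) O))
    with (O := Q) as [y [Qy Hy]].
  - intros n U [HU [u Uu]].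
    destruct (classic (subset (closure T (f n)) O)) as [Hs|Hs].
    + destruct (classic (subset U (closure T (f n)))) as [HUc|HUc].
      * destruct Hno. exists n. split; [split; [apply interior_open|]|].
        -- exists u. now exists U.
        -- intros z Hz. apply Hs. exact (interior_subset T _ z Hz).
      * apply not_all_ex_not in HUc as [z Hz]. apply imply_to_and in Hz as [Uz Hz].
        destruct (not_closure T _ z Hz) as [V [HV [Vz HVn]]].
        exists (fun y => U y /\ V y). split; [split; [now apply open_inter|now exists z]|].
        split; [now intros y [Hy _]|]. intros y [_ Vy] [Hy _]. now apply (HVn y).
    + exists U. split; [split; [auto|now exists u]|]. split; [easy|]. now intros y _ [_ Hy].
  - split; [auto|now exists x].
  - destruct (HQN y Qy) as [N [FN [HNO Ny]]]. destruct (Hf N FN) as [n <-].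
    apply (Hy n). split; auto. intros z Hz. apply HO1O. now apply (closure_mono T _ _ HNO).
Qed.

(** Near any point the closure of at most one member is met, so the claim reduces to a single closed
    set: an open set either lies inside it, hence in its interior, or has an open part outside
    it. *)
Lemma discrete_boundaries_nowhere_dense {X : Type} (T : Topology X) (D : family X) :
  discrete_family T D ->
  nowhere_dense T (fun y => exists N, D N /\ closure T N y /\ ~ interior T (closure T N) y).
Proof.
  intros HD U [HU [u Uu]].
  destruct (HD u) as [Q [[Q' [HQ' [Q'u HQ'Q]]] Hdisc]].
  set (U1 := fun y => U y /\ Q' y).
  assert (HU1 : is_open T U1) by now apply open_inter.
  assert (Hsame : forall N1 N2 y1 y2, D N1 -> D N2 -> U1 y1 -> U1 y2 ->
    closure T N1 y1 -> closure T N2 y2 -> N1 = N2).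
  { intros N1 N2 y1 y2 H1 H2 Hy1 Hy2 Hc1 Hc2. apply set_ext. apply Hdisc; auto.
    - destruct (Hc1 U1 HU1 Hy1) as [z [[_ Qz] Nz]]. exists z. auto.
    - destruct (Hc2 U1 HU1 Hy2) as [z [[_ Qz] Nz]]. exists z. auto. }
  destruct (classic (exists N y, D N /\ U1 y /\ closure T N y)) as [[N [y0 [DN [Uy0 Ny0]]]]|Hn].
  - destruct (classic (subset U1 (closure T N))) as [Hs|Hs].
    + exists U1. split; [split; [auto|now exists y0]|]. split; [now intros y [Hy _]|].
      intros y Uy [N' [DN' [Hc Hi]]].
      rewrite <- (Hsame N N' y0 y) in Hi; auto. apply Hi. now exists U1.
    + apply not_all_ex_not in Hs as [z Hz]. apply imply_to_and in Hz as [Uz Hz].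
      destruct (not_closure T _ z Hz) as [V [HV [Vz HVn]]].
      exists (fun y => U1 y /\ V y).
      split; [split; [now apply open_inter|now exists z]|].
      split; [now intros y [[Hy _] _]|]. intros y [Uy Vy] [N' [DN' [Hc Hi]]].
      rewrite <- (Hsame N N' y0 y) in Hc; auto.
      destruct (Hc V HV Vy) as [a [Va Na]]. now apply (HVn a).
  - exists U1. split; [split; [auto|now exists u]|]. split; [now intros y [Hy _]|].
    intros y Uy [N [DN [Hc _]]]. apply Hn. now exists N, y.
Qed.

(* At a point lying on no boundary of a (closed) network member, the interiors of
   the members containing the point form a base, and each discrete layer contributes
   at most one of them. *)
Lemma sigma_space_countable_base {X : Type} (T : Topology X) :
  sigma_space T -> choquet T -> nonempty (fun _ : X => True) ->
  exists x, countable_base_at T x.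
Proof.
  intros [[_ Hreg] [F [[D [HD HF]] HN]]] HC Hne.
  destruct (choquet_baire T HC (fun n y =>
    exists N, D n N /\ closure T N y /\ ~ interior T (closure T N) y))
    with (O := fun _ : X => True) as [x [_ Hx]].
  { intros n. now apply discrete_boundaries_nowhere_dense. }
  { split; [apply open_full|auto]. }
  exists x.
  destruct (choice (fun n B => forall N, D n N -> N x -> B = interior T (closure T N)))
    as [B HB].
  { intros n. destruct (classic (exists N, D n N /\ N x)) as [[N [DN Nx]]|Hn].
    (* By discreteness all members of the layer that contain [x] are equal, so [B n] does not depend
       on the one selected. *)
    - exists (interior T (closure T N)). intros N' DN' N'x. do 2 f_equal.
      destruct (HD n x) as [U [[U' [_ [U'x HU']]] Hdisc]].
      apply set_ext. apply Hdisc; auto; exists x; auto.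
    - exists (fun _ => True). intros N DN Nx. destruct Hn. now exists N. }
  apply countable_base_at_intro with B. intros O HO Ox.
  destruct (Hreg x O HO Ox) as [O1 [HO1 [O1x HO1O]]].
  destruct (HN x O1) as [Q [HQ [Qx HQN]]]; [now exists O1|].
  destruct (HQN x Qx) as [N [FN [HNO Nx]]]. apply HF in FN as [n DN].
  exists n. rewrite (HB n N DN Nx). split; [apply interior_open|split].
  - apply NNPP. intros Hi. apply (Hx n). exists N. split; [auto|split; [|auto]].
    now apply subset_closure.
  - intros z Hz. apply HO1O, (closure_mono T _ _ HNO). exact (interior_subset T _ z Hz).
Qed.

(** * Topological groups *)

Section TopologicalGroup.

Context {X : Type} {T : Topology X} {mul : X -> X -> X} {inv : X -> X} {e : X}.
Context (HG : topological_group T mul inv e).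

Local Infix "*" := mul.

Lemma group_assoc a b c : a * (b * c) = a * b * c.
Proof. apply HG. Qed.

Lemma group_unit_l a : e * a = a.
Proof. apply HG. Qed.

Lemma group_inv_l a : inv a * a = e.
Proof. apply HG. Qed.

(** Derived from the left axioms by multiplying with [inv (inv a) * inv a] on the left. *)
Lemma group_inv_r a : a * inv a = e.
Proof.
  rewrite <- (group_unit_l (a * inv a)), <- (group_inv_l (inv a)) at 1.
  rewrite <- group_assoc, (group_assoc (inv a) a (inv a)), group_inv_l, group_unit_l.
  apply group_inv_l.
Qed.

Lemma group_unit_r a : a * e = a.
Proof.
  now rewrite <- (group_inv_l a), group_assoc, group_inv_r, group_unit_l.
Qed.

Lemma group_mulVK a b : inv a * (a * b) = b.
Proof. now rewrite group_assoc, group_inv_l, group_unit_l. Qed.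

Lemma group_mulKV a b : a * (inv a * b) = b.
Proof. now rewrite group_assoc, group_inv_r, group_unit_l. Qed.

Lemma group_inv_unique a b : a * b = e -> b = inv a.
Proof. intros H. now rewrite <- (group_mulVK a b), H, group_unit_r. Qed.

Lemma group_inv_inv a : inv (inv a) = a.
Proof. symmetry. apply group_inv_unique, group_inv_l. Qed.

Lemma group_inv_e : inv e = e.
Proof. symmetry. apply group_inv_unique, group_unit_l. Qed.

Lemma group_inv_mul a b : inv (a * b) = inv b * inv a.
Proof.
  symmetry. apply group_inv_unique.
  now rewrite <- group_assoc, group_mulKV, group_inv_r.
Qed.

(** * Translations and neighborhoods of the unit *)

Lemma mul_continuous a b W : is_open T W -> W (a * b) ->
  exists U V, is_open T U /\ is_open T V /\ U a /\ V b /\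
    (forall u v, U u -> V v -> W (u * v)).
Proof. apply HG. Qed.

Lemma inv_open W : is_open T W -> is_open T (fun x => W (inv x)).
Proof. apply HG. Qed.

Lemma left_translation_open a W : is_open T W -> is_open T (fun g => W (a * g)).
Proof.
  intros HW. apply open_of_local. intros g Wg.
  destruct (mul_continuous a g W HW Wg) as (U & V & HU & HV & Ua & Vg & H).
  exists V. repeat split; auto. intros v Hv. auto.
Qed.

Lemma right_translation_open a W : is_open T W -> is_open T (fun g => W (g * a)).
Proof.
  intros HW. apply open_of_local. intros g Wg.
  destruct (mul_continuous g a W HW Wg) as (U & V & HU & HV & Ug & Va & H).
  exists U. repeat split; auto. intros v Hv. auto.
Qed.

(** An open set containing [x] but not [y] pulls back under left translation by [x] to a
    neighborhood of the unit missing [inv x * y]. *)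
Lemma group_separated x y : (forall O, is_open T O -> O e -> O (inv x * y)) -> x = y.
Proof.
  intros H. apply NNPP. intros Hxy.
  assert (HH : hausdorff T) by apply HG.
  destruct (HH x y Hxy) as (U & V & HU & _ & Ux & Vy & Hdisj).
  apply (Hdisj y); auto. rewrite <- (group_mulKV x y).
  apply (H (fun g => U (x * g))).
  - now apply left_translation_open.
  - now rewrite group_unit_r.
Qed.

Lemma division_nbhd O : is_open T O -> O e ->
  exists V, is_open T V /\ V e /\ forall a b, V a -> V b -> O (inv a * b).
Proof.
  intros HO Oe.
  destruct (mul_continuous e e O HO) as (U & V & HU & HV & Ue & Ve & H).
  { now rewrite group_unit_l. }
  exists (fun g => U (inv g) /\ V g). split; [|split].
  - apply open_inter; auto. now apply inv_open.
  - now rewrite group_inv_e.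
  - intros a b [Ua _] [_ Vb]. auto.
Qed.

(** Cubes, rather than squares, match the threefold composition of entourages required for
    metrization. *)
Lemma symmetric_cube_root O : is_open T O -> O e ->
  exists V, is_open T V /\ V e /\ (forall g, V g -> V (inv g)) /\
    forall a b c, V a -> V b -> V c -> O (a * b * c).
Proof.
  intros HO Oe.
  destruct (mul_continuous e e O HO) as (U1 & V1 & HU1 & HV1 & U1e & V1e & H1).
  { now rewrite group_unit_l. }
  destruct (mul_continuous e e U1 HU1) as (U2 & V2 & HU2 & HV2 & U2e & V2e & H2).
  { now rewrite group_unit_l. }
  set (W := fun g => U2 g /\ V2 g /\ V1 g).
  assert (HW : is_open T W) by (repeat apply open_inter; auto).
  exists (fun g => W g /\ W (inv g)). split; [|split; [|split]].
  - apply open_inter; auto. now apply inv_open.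
  - rewrite group_inv_e. unfold W. auto.
  - intros g [H H']. rewrite group_inv_inv. auto.
  - intros a b c [Ha _] [Hb _] [Hc _]. unfold W in *. apply H1; [apply H2|]; tauto.
Qed.

(** * Countable bases at the unit *)

Lemma countable_base_at_translate x : countable_base_at T x -> countable_base_at T e.
Proof.
  intros [B [HB Hbase]]. exists (fun n g => B n (x * g)). split.
  - intros n. split; [apply left_translation_open, HB|].
    rewrite group_unit_r. apply HB.
  - intros O HO Oe. destruct (Hbase (fun y => O (inv x * y))) as [n Hn].
    + now apply left_translation_open.
    + now rewrite group_inv_l.
    + exists n. intros g Hg. rewrite <- (group_mulVK x g). now apply Hn.
Qed.

(** The base consists of the quotient sets P^-1 P: such a set is open, contains the unit as soon as
    P is non-empty, and lies in V^-1 V when P lies in V. *)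
Lemma countable_base_of_pi_base (P : nat -> X -> Prop) :
  (forall O, is_open T O -> O e -> exists n, nonempty_open T (P n) /\ subset (P n) O) ->
  countable_base_at T e.
Proof.
  intros HP. apply countable_base_at_intro with (fun n g => exists a, P n a /\ P n (a * g)).
  intros O HO Oe. destruct (division_nbhd O HO Oe) as [V [HV [Ve HVO]]].
  destruct (HP V HV Ve) as [n [[Hn [a Pa]] HnV]]. exists n. split; [|split].
  - apply open_of_local. intros g [b [Pb Pbg]].
    exists (fun h => P n (b * h)).
    split; [now apply left_translation_open|split; [auto|]].
    intros h Hh. now exists b.
  - exists a. now rewrite group_unit_r.
  - intros g [b [Pb Pbg]]. rewrite <- (group_mulVK b g). auto.
Qed.

(** * Cauchy sequences and completeness *)

(** Applied to the sequence of inverses, this is the Cauchy condition for the right uniformity. *)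
Definition left_cauchy (x : nat -> X) : Prop :=
  forall O, is_open T O -> O e -> exists K, forall k m, (K <= k)%nat -> (K <= m)%nat ->
    O (inv (x k) * x m).

(** Half a round of the double game: from x_k V inside U for late k, [U] is shrunk to a [W]-small U'
    with x_k^-1 U' inside V for late k. The set U' surrounds a point x_m v with [v] in [V] and [m]
    late. *)
Lemma left_cauchy_swap (x : nat -> X) U V W :
  left_cauchy x -> nonempty_open T V -> is_open T U -> is_open T W -> W e ->
  (exists K, forall v k, V v -> (K <= k)%nat -> U (x k * v)) ->
  exists U', nonempty_open T U' /\ subset U' U /\
    (forall a b, U' a -> U' b -> W (inv a * b)) /\
    exists K, forall u k, U' u -> (K <= k)%nat -> V (inv (x k) * u).
Proof.
  intros Hx [HV [v Vv]] HU HW We [K HK].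
  destruct (mul_continuous v e V HV) as (V1 & O & HV1 & HO & V1v & Oe & HV1O).
  { now rewrite group_unit_r. }
  destruct (division_nbhd W HW We) as (W1 & HW1 & W1e & HW1W).
  destruct (Hx (fun g => V1 (g * v))) as [K' HK'].
  { now apply right_translation_open. }
  { now rewrite group_unit_l. }
  (* Being past [K] puts [p] in [U]; being past [K'] puts x_k^-1 p = (x_k^-1 x_m) v in [V1] for late
     k. *)
  set (m := Nat.max K K'). set (p := x m * v).
  exists (fun u => U u /\ O (inv p * u) /\ W1 (inv p * u)). split; [|split; [|split]].
  - split.
    + apply open_inter; auto. apply open_inter; now apply left_translation_open.
    + exists p. rewrite group_inv_l. split; [|auto]. apply HK; auto. lia.
  - now intros u [Hu _].
  - intros a b (_ & _ & Ha) (_ & _ & Hb).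
    rewrite <- (group_mulKV p b), group_assoc.
    replace (inv a * p) with (inv (inv p * a)); [auto|].
    now rewrite group_inv_mul, group_inv_inv.
  (* Here x_k^-1 u is the product of x_k^-1 p in [V1] and p^-1 u in [O]. *)
  - exists K'. intros u k (_ & Hu & _) Hk.
    rewrite <- (group_mulKV p u). unfold p at 1.
    rewrite !group_assoc, <- (group_assoc _ (inv p) u).
    apply HV1O; auto. apply HK'; auto. lia.
Qed.

(* Two plays are run simultaneously. In the completion of the group the sequence
   converges to some [y], and the open sets [U] and [V] of the two plays are kept
   such that [y V] lies in [U], in turn refined so that [y^-1 U] lies in [V]; so the
   points [z] and [w] won in the two plays satisfy [z = y w], that is [y = z w^-1]. *)
Lemma choquet_group_complete (W : nat -> X -> Prop) (x : nat -> X) :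
  choquet T ->
  (forall n, is_open T (W n) /\ W n e) ->
  (forall O, is_open T O -> O e -> exists n, subset (W n) O) ->
  left_cauchy x -> left_cauchy (fun k => inv (x k)) ->
  exists y, forall O, is_open T O -> O y -> exists K, forall k, (K <= k)%nat -> O (x k).
Proof.
  intros HC HW Hbase Hx Hx'.
  destruct (choquet_positions T HC) as [P [p0 [next [reply [Hr Hwin]]]]].
  set (rel := fun V U => exists K, forall v k, V v -> (K <= k)%nat -> U (x k * v)).
  set (inv_rel := fun U V => exists K, forall u k, U u -> (K <= k)%nat -> V (inv (x k) * u)).
  (* One round: the first swap shrinks [U], N replies to the result, and a second swap, for the
     inverse sequence, shrinks [V] so that x_k V' lies in that reply for late k. N's reply to V'
     inherits the relation, so the next round can start from the two replies. *)
  assert (Hround : forall n p U V, nonempty_open T U -> nonempty_open T V -> rel V U ->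
    exists U' V', nonempty_open T U' /\ nonempty_open T V' /\ subset U' U /\ subset V' V /\
      (forall a b, U' a -> U' b -> W n (inv a * b)) /\ rel V' (reply p U')).
  { intros n p U V HU HV HVU. destruct (HW n) as [HWn Wne].
    destruct (left_cauchy_swap x U V (W n) Hx HV (proj1 HU) HWn Wne HVU)
      as (U' & HU' & HU'U & Hsmall & HU'V).
    destruct (Hr p U' HU') as [Hr1 Hr2].
    destruct (left_cauchy_swap (fun k => inv (x k)) V (reply p U') (fun _ => True))
      as (V' & HV' & HV'V & _ & HV'U).
    - auto.
    - auto.
    - apply HV.
    - apply open_full.
    - easy.
    - destruct HU'V as [K HK]. exists K. intros u k Hu Hk. apply HK; auto.
    - exists U', V'. split; [auto|split; [auto|split; [auto|split; [auto|split; [auto|]]]]].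
      destruct HV'U as [K HK]. exists K. intros v k Hv Hk.
      rewrite <- (group_inv_inv (x k)). now apply HK. }
  destruct (dependent_choice
    (fun n (s : (P * (X -> Prop)) * (P * (X -> Prop))) =>
       let '((p, U), (q, V)) := s in
       (n = 0%nat -> p = p0 /\ q = p0) /\ nonempty_open T U /\ nonempty_open T V /\
       (forall a b, U a -> U b -> W n (inv a * b)) /\ rel V (reply p U))
    (fun n s s' => let '((p, U), (q, V)) := s in let '((p', U'), (q', V')) := s' in
       p' = next p U /\ q' = next q V /\ subset U' (reply p U) /\ subset V' (reply q V)))
    as [f Hf].
  - assert (Hfull : nonempty_open T (fun _ => True)) by (split; [apply open_full|now exists e]).
    destruct (Hround 0%nat p0 (fun _ => True) (fun _ => True)) as
      (U & V & HU & HV & _ & _ & Hsmall & HVU); auto.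
    { now exists 0%nat. }
    now exists ((p0, U), (p0, V)).
  - intros n [[p U] [q V]] (_ & HU & HV & _ & [K HK]).
    destruct (Hr p U HU) as [HU1 HU2]. destruct (Hr q V HV) as [HV1 HV2].
    destruct (Hround (S n) (next p U) (reply p U) (reply q V)) as
      (U' & V' & HU' & HV' & HU'U & HV'V & Hsmall & HVU); auto.
    { exists K. intros v k Hv Hk. apply HK; auto. }
    exists ((next p U, U'), (next q V, V')).
    split; [split; [discriminate|]|]; auto.
  - set (p := fun n => fst (fst (f n))). set (U := fun n => snd (fst (f n))).
    set (q := fun n => fst (snd (f n))). set (V := fun n => snd (snd (f n))).
    assert (Hinv : forall n, (n = 0%nat -> p n = p0 /\ q n = p0) /\
      nonempty_open T (U n) /\ nonempty_open T (V n) /\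
      (forall a b, U n a -> U n b -> W n (inv a * b)) /\ rel (V n) (reply (p n) (U n))).
    { intros n. destruct (Hf n) as [H _]. unfold p, U, q, V.
      now destruct (f n) as [[pn Un] [qn Vn]]. }
    assert (Hstep : forall n, p (S n) = next (p n) (U n) /\ q (S n) = next (q n) (V n) /\
      subset (U (S n)) (reply (p n) (U n)) /\ subset (V (S n)) (reply (q n) (V n))).
    { intros n. destruct (Hf n) as [_ H]. unfold p, U, q, V.
      destruct (f n) as [[pn Un] [qn Vn]]. now destruct (f (S n)) as [[pn' Un'] [qn' Vn']]. }
    destruct (Hwin p U) as [z Hz]; try (intros n; apply Hstep || apply Hinv).
    { now apply Hinv. }
    destruct (Hwin q V) as [w Hw]; try (intros n; apply Hstep || apply Hinv).
    { now apply Hinv. }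
    exists (z * inv w). intros O HO Ozw.
    (* For late k both [z] and x_k w lie in [U n], so z^-1 x_k w is in [W n]; [n] is chosen so that
       z (W n) w^-1 lies in [O], and this set contains x_k. *)
    destruct (Hbase (fun g => O (z * g * inv w))) as [n Hn].
    + now apply (left_translation_open z (fun g => O (g * inv w))), right_translation_open.
    + now rewrite group_unit_r.
    + destruct (Hinv n) as (_ & HU & _ & Hsmall & [K HK]).
      exists K. intros k Hk.
      replace (x k) with (z * (inv z * (x k * w)) * inv w).
      * apply Hn, Hsmall; auto. apply (Hr (p n) (U n) HU). now apply HK.
      * now rewrite group_mulKV, <- group_assoc, group_inv_r, group_unit_r.
Qed.

(* The entourages are those of the two-sided uniformity, the one in which
   choquet_group_complete provides limits of Cauchy sequences. *)
Lemma choquet_group_complete_metrizable :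
  choquet T -> countable_base_at T e -> complete_metrizable T.
Proof.
  intros HC [B [HB Hbase]].
  (* Symmetric neighborhoods in which the cube of each lies in the preceding one. The index is
     shifted, with [W (S m)] inside [B m], so that [W 0] is the whole group and the entourage of
     index 0 is total. *)
  destruct (dependent_choice
    (fun n V => is_open T V /\ V e /\ (forall g, V g -> V (inv g)) /\
       match n with 0%nat => forall g, V g | S m => subset V (B m) end)
    (fun n V V' => forall a b c, V' a -> V' b -> V' c -> V (a * b * c))) as [W HW].
  - exists (fun _ => True). repeat split; auto. apply open_full.
  - intros n V (HV & Ve & _ & _). destruct (HB n) as [HBn Bne].
    destruct (symmetric_cube_root (fun g => V g /\ B n g)) as (V' & HV' & V'e & Hsym & Hcube).
    + now apply open_inter.
    + auto.
    + exists V'. split; [split; [auto|split; [auto|split; [auto|]]]|].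
      * intros g Hg. rewrite <- (group_unit_r g), <- (group_unit_r (g * e)).
        now apply Hcube.
      * intros a b c Ha Hb Hc. now apply Hcube.
  - assert (HWe : forall n, is_open T (W n) /\ W n e) by (intros n; split; apply HW).
    assert (HWbase : forall O, is_open T O -> O e -> exists n, subset (W n) O).
    { intros O HO Oe. destruct (Hbase O HO Oe) as [n Hn].
      exists (S n). intros g Hg. apply Hn. now apply (HW (S n)). }
    assert (HWsym : forall n g, W n g -> W n (inv g)) by (intros n; apply HW).
    set (E := fun n a b => W n (inv a * b) /\ W n (a * inv b)).
    destruct (entourage_metrization E) as [d [Hm [Hd1 Hd2]]].
    { intros a b. destruct (HW 0%nat) as [(_ & _ & _ & H) _]. now split. }
    { intros n a. unfold E. rewrite group_inv_l, group_inv_r. split; apply HWe. }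
    { intros n a b [H1 H2]. apply HWsym in H1, H2.
      rewrite group_inv_mul, group_inv_inv in H1, H2. now split. }
    { intros n a b c g [H1 H1'] [H2 H2'] [H3 H3']. destruct (HW n) as [_ Hcube]. split.
      - replace (inv a * g) with (inv a * b * (inv b * c) * (inv c * g)); [now apply Hcube|].
        now rewrite <- !group_assoc, !group_mulKV.
      - replace (a * inv g) with (a * inv b * (b * inv c) * (c * inv g)); [now apply Hcube|].
        now rewrite <- !group_assoc, !group_mulVK. }
    { intros a b H. apply group_separated. intros O HO Oe.
      destruct (HWbase O HO Oe) as [n Hn]. apply Hn, H. }
    assert (Hind : metric_induces T d).
    { intros U. split.
      - intros HU a Ua. destruct (HWbase (fun g => U (a * g))) as [n Hn].
        + now apply left_translation_open.
        + now rewrite group_unit_r.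
        + exists ((/2) ^ n). split; [apply half_pow_pos|]. intros b Hb.
          rewrite <- (group_mulKV a b). apply Hn, Hd2, Hb.
      - intros HU. apply open_of_local. intros a Ua. destruct (HU a Ua) as [eps [Heps H]].
        destruct (half_pow_small eps Heps) as [n Hn].
        exists (E n a). split; [|split].
        + apply open_inter; [apply left_translation_open, HWe|].
          apply (inv_open (fun g => W n (a * g))), left_translation_open, HWe.
        + unfold E. rewrite group_inv_l, group_inv_r. split; apply HWe.
        + intros b Hb. apply H. apply Hd1 in Hb. lra. }
    exists d. split; [auto|split; [auto|]]. intros x Hx.
    assert (HxE : forall n, exists K, forall k m, (K <= k)%nat -> (K <= m)%nat ->
      E n (x k) (x m)).
    { intros n. destruct (Hx _ (half_pow_pos n)) as [K HK]. exists K. auto. }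
    (* The two components of [E n] supply the left Cauchy condition for [x] and for its inverses
       respectively. *)
    destruct (choquet_group_complete W x HC HWe HWbase) as [y Hy].
    + intros O HO Oe. destruct (HWbase O HO Oe) as [n Hn]. destruct (HxE n) as [K HK].
      exists K. intros k m Hk Hm'. apply Hn. now apply HK.
    + intros O HO Oe. destruct (HWbase O HO Oe) as [n Hn]. destruct (HxE n) as [K HK].
      exists K. intros k m Hk Hm'. rewrite group_inv_inv. apply Hn. now apply HK.
    + exists y. intros eps Heps. destruct (Hy (ball d y eps)) as [K HK].
      * now apply ball_open.
      * now apply ball_center.
      * exists K. intros k Hk. destruct Hm as (_ & _ & Hsym & _). rewrite Hsym.
        now apply HK.
Qed.

End TopologicalGroup.

(** * The equivalences, each passing through complete metrizability *)

Theorem theorem5 (X : Type) (T : Topology X)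
  (mul : X -> X -> X) (inv : X -> X) (e : X)
  (HG : topological_group T mul inv e) :
  (complete_metrizable T <-> point_cosmic T /\ choquet T) /\
  (point_cosmic T /\ choquet T <-> choquet T /\ sigma_space T).
Proof.
  assert (H12 : complete_metrizable T -> point_cosmic T /\ choquet T).
  { intros H. split; [|now apply complete_metrizable_choquet].
    destruct H as [d [Hm [Hind _]]]. now apply metric_point_cosmic with d. }
  assert (H13 : complete_metrizable T -> sigma_space T).
  { intros [d [Hm [Hind _]]]. now apply metric_sigma_space with d. }
  assert (H21 : point_cosmic T /\ choquet T -> complete_metrizable T).
  { intros [[Hreg Hnet] HC]. destruct (Hnet e) as [F [HF HN]].
    destruct (network_at_pi_base T e F Hreg HC HF HN) as [P HP].
    apply (choquet_group_complete_metrizable HG HC).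
    now apply (countable_base_of_pi_base HG) with P. }
  assert (H31 : choquet T /\ sigma_space T -> complete_metrizable T).
  { intros [HC HS]. destruct (sigma_space_countable_base T HS HC) as [x Hx]; [now exists e|].
    apply (choquet_group_complete_metrizable HG HC).
    now apply (countable_base_at_translate HG) with x. }
  tauto.
Qed.
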